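(* Let $n>m\geq1$, let $(\pi,V)$ be an $R[G_n]$-module and $(\pi',V')$ an $R[G_m]$-module, both of Whittaker type, with $\pi'$ not exceptional for $\pi$. Write $\mathcal{W}=\mathcal{W}(V,\psi_R)$, $\mathcal{W}'=\mathcal{W}(V',\psi_R^{-1})$, and regard $\mathcal{W}'$ as a representation of $H=G_mU_{n,n-m-1}$ with $U_{n,n-m-1}$ acting trivially. Then the $R$-module of $R$-bilinear maps $B:\mathcal{W}\times\mathcal{W}'\to R$ satisfying $B(hW,hW')=\chi(h)B(W,W')$ for all $h\in H$ is free of rank one, generated by \[I(W,W';0)=\sum_{g\in N_m\backslash G_m}W\begin{pmatrix}g&0\\0&I_{n-m}\end{pmatrix}W'(g).\]
   Context: Let $p$ be a prime, $q$ a power of $p$, $G_n=\mathrm{GL}_n(\mathbb{F}_q)$, $R$ a commutative Noetherian $\mathbb{Z}[\frac1p,\zeta_p]$-algebra with $0\neq1$ ($\zeta_p$ a primitive $p$-th root of unity). Fix nontrivial $\psi:(\mathbb{F}_q,+)\to\mathbb{Z}[\frac1p,\zeta_p]^\times$ and let $\psi_R$ be its image in $R^\times$. $N_n$ is the upper unipotent subgroup, with character $\psi_R(u)=\psi_R(\sum_{i=1}^{n-1}u_{i,i+1})$; the same formula defines $\psi_R$ on $U_{n,n-m-1}=\{\begin{psmallmatrix}I_{m+1}&z\\0&y\end{psmallmatrix}: z\in\mathrm{Mat}_{m+1,n-m-1}(\mathbb{F}_q), y\in N_{n-m-1}\}$. $G_m$ is embedded in $G_n$ in the top left corner; it normalizes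 $U_{n,n-m-1}$, and $\chi$ is the character of $H=G_mU_{n,n-m-1}$ trivial on $G_m$ and equal to $\psi_R$ on $U_{n,n-m-1}$. $H$ acts on $\mathcal W$ by right translation. $P_n$ is the mirabolic subgroup (last row $(0,\dots,0,1)$), $U_n=\{\begin{psmallmatrix}I_{n-1}&y\\0&1\end{psmallmatrix}\}$ with $\psi_R$ given by $y_{n-1}$. For an $R[P_n]$-module $V$: $\Phi^-(V)=V/\langle uv-\psi_R(u)v\rangle_{u\in U_n}$ (an $R[P_{n-1}]$-module), $\Psi^-(V)=V/\langle uv-v\rangle_{u\in U_n}$ (an $R[G_{n-1}]$-module), $V^{(k)}=\Psi^-(\Phi^-)^{k-1}(V)\in\mathrm{Rep}_R(G_{n-k})$ for $1\le k\le n$, $V^{(0)}=V$; for $G_n$-modules use the restriction to $P_n$. $V^{(n)}$ is the $(N_n,\psi_R)$-coinvariants. $V$ is of Whittaker type if $V^{(n)}$ is free of rank one over $R$; then a generator $\lambda$ of $\mathrm{Hom}_R(V^{(n)},R)$ gives $V\to\mathrm{Ind}_{N_n}^{G_n}\psi_R$, $v\mapsto(g\mapsto\lambda(\overline{gv}))$, whose image is the Whittaker model $\mathcal{W}(V,\psi_R)$. Replacing $\psi_R$ by $\psi_R^{-1}$ gives derivatives with respect to $\psi_R^{-1}$ and $\mathcal{W}(V',\psi_R^{-1})$. $\pi'$ is exceptional for $\pi$ if for some $t\in\{1,\dots,m\}$ there is a nonzero $G_t$-invariant $R$-bilinear form on $\mathcal{W}(V,\psi_R)^{(n-t)}\times\mathcal{W}(V',\psi_R^{-1})^{(m-t)}$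 (the latter derivative with respect to $\psi_R^{-1}$). *)

(* Defs.v *)
From HB Require Import structures.
From mathcomp Require Import all_boot all_order all_algebra.
Set Implicit Arguments. Unset Strict Implicit. Unset Printing Implicit Defensive.
Import Order.TTheory GRing.Theory Num.Theory.
Local Open Scope ring_scope.

Section Defs.
Variables (F : finFieldType) (R : comNzRingType).

Definition is_ideal (I : R -> Prop) : Prop :=
  [/\ I 0, (forall x y, I x -> I y -> I (x + y)) & (forall r x, I x -> I (r * x))].

Definition noetherian : Prop :=
  forall I : R -> Prop, is_ideal I ->
    exists s : seq R, forall x, I x <->
      exists c : seq R, size c = size s /\ x = \sum_(i < size s) c`_i * s`_i.

Definition mxget (k : nat) (g : 'M[F]_k) (i j : nat) : F :=
  match (insub i : option 'I_k), (insub j : option 'I_k) with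
  | Some i', Some j' => g i' j'
  | _, _ => 0
  end.

Definition embmx (n k : nat) (g : 'M[F]_k) : 'M[F]_n :=
  \matrix_(i < n, j < n)
     if (i < k)%N && (j < k)%N then mxget g i j else ((i : nat) == j)%:R.

Definition Nmx (k : nat) : pred 'M[F]_k := fun u =>
  [forall i : 'I_k, forall j : 'I_k, ((j < i)%N ==> (u i j == 0)) && ((i == j) ==> (u i j == 1))].

(** U_r = { (I_{r-1} y ; 0 1) } inside G_r. *)
Definition Umx (r : nat) : pred 'M[F]_r := fun u =>
  [forall i : 'I_r, forall j : 'I_r,
     ((j : nat) != r.-1) || ((i : nat) == r.-1) ==> (u i j == ((i == j)%:R))].

(** U_{n,n-m-1} = { (I_{m+1} z ; 0 y) : y in N_{n-m-1} } inside G_n. *)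
Definition Uhmx (n m : nat) : pred 'M[F]_n := fun u =>
  [forall i : 'I_n, forall j : 'I_n,
     [&& ((j < i)%N ==> (u i j == 0)), ((i == j) ==> (u i j == 1))
       & (((i < j)%N && (j <= m)%N) ==> (u i j == 0))]].

Definition psiN (chi : F -> R) (n : nat) (u : 'M[F]_n) : R :=
  chi (\sum_(i < n.-1) mxget u i i.+1).

Definition is_rep (n : nat) (V : lmodType R) (pi : 'M[F]_n -> V -> V) : Prop :=
  [/\ forall g, g \in unitmx -> forall (a : R) x y, pi g (a *: x + y) = a *: pi g x + pi g y,
      forall x, pi 1%:M x = x
    & forall g h x, g \in unitmx -> h \in unitmx -> pi (g *m h) x = pi g (pi h x)].

Definition span (M : lmodType R) (S : M -> Prop) : M -> Prop := fun x =>
  exists s : seq (R * M), (forall c, c \in s -> S c.2) /\ x = \sum_(c <- s) c.1 *: c.2.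

(** Generators  pi(u) v - chi(y_{r-1}) v  (tw = true, a Phi^- step) or
    pi(u) v - v (tw = false, a Psi^- step), for u in U_r embedded in G_n and
    v in the module S (a submodule of M stable under act). *)
Definition gen_step (chi : F -> R) (n : nat) (M : lmodType R) (S : M -> Prop)
    (act : 'M[F]_n -> M -> M) (r : nat) (tw : bool) : M -> Prop := fun w =>
  exists (u : 'M[F]_r) (v : M), [/\ u \in @Umx r, S v &
    w = act (embmx n u) v - (if tw then chi (mxget u r.-2 r.-1) else 1) *: v].

(** Kernel (inside S) of the projection S -> S^{(k)} = Psi^- (Phi^-)^{k-1} (S);
    the k-th derivative S^{(k)} is S modulo this submodule. *)
Definition deriv_ker (chi : F -> R) (n : nat) (M : lmodType R) (S : M -> Prop)
    (act : 'M[F]_n -> M -> M) (k : nat) : M -> Prop :=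
  if k is 0 then (fun w => w = 0) else
  span (fun w => (exists j, (j < k.-1)%N /\ gen_step chi S act (n - j) true w)
                 \/ gen_step chi S act (n - k.-1) false w).

Definition Rlinear (V : lmodType R) (f : V -> R) : Prop :=
  forall (a : R) x y, f (a *: x + y) = a * f x + f y.

(** V is of Whittaker type: V^{(n)} is free of rank one, i.e. there is an
    R-linear surjection V -> R whose kernel is ker(V -> V^{(n)}). *)
Definition whittaker_type (chi : F -> R) (n : nat) (V : lmodType R)
    (pi : 'M[F]_n -> V -> V) : Prop :=
  exists lam0 : V -> R, [/\ Rlinear lam0, (forall r, exists v, lam0 v = r) &
    forall v, lam0 v = 0 <-> deriv_ker chi (fun _ => True) pi n v].

(** lam (viewed on V^{(n)}) is a generator of Hom_R(V^{(n)}, R). *)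
Definition whittaker_functional (chi : F -> R) (n : nat) (V : lmodType R)
    (pi : 'M[F]_n -> V -> V) (lam : V -> R) : Prop :=
  [/\ Rlinear lam,
      (forall v, deriv_ker chi (fun _ => True) pi n v -> lam v = 0) &
      forall mu : V -> R, Rlinear mu ->
        (forall v, deriv_ker chi (fun _ => True) pi n v -> mu v = 0) ->
        exists r : R, forall v, mu v = r * lam v].

Definition rho (n : nat) (g : 'M[F]_n) (f : {ffun 'M[F]_n -> R^o}) : {ffun 'M[F]_n -> R^o} :=
  [ffun x => f (x *m g)].

Definition whit (n : nat) (V : lmodType R) (pi : 'M[F]_n -> V -> V) (lam : V -> R)
    (v : V) : {ffun 'M[F]_n -> R^o} :=
  [ffun x => if x \in unitmx then lam (pi x v) else 0].

Definition Wmodel (n : nat) (V : lmodType R) (pi : 'M[F]_n -> V -> V) (lam : V -> R)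
    : {ffun 'M[F]_n -> R^o} -> Prop :=
  fun f => exists v, f = whit pi lam v.

Definition bilinear_on (n m : nat) (W : {ffun 'M[F]_n -> R^o} -> Prop)
    (W' : {ffun 'M[F]_m -> R^o} -> Prop)
    (B : {ffun 'M[F]_n -> R^o} -> {ffun 'M[F]_m -> R^o} -> R) : Prop :=
  (forall (a : R) f1 f2 f', W f1 -> W f2 -> W' f' ->
     B (a *: f1 + f2) f' = a * B f1 f' + B f2 f') /\
  (forall (a : R) f f1' f2', W f -> W' f1' -> W' f2' ->
     B f (a *: f1' + f2') = a * B f f1' + B f f2').

(** pi' is exceptional for pi: for some 1 <= t <= m there is a nonzero
    G_t-invariant bilinear form on W^{(n-t)} x W'^{(m-t)}, i.e. a nonzero
    G_t-invariant bilinear form on W x W' vanishing on the kernels of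
    W -> W^{(n-t)} and W' -> W'^{(m-t)}. *)
Definition exceptional (chi chi' : F -> R) (n m : nat)
    (W : {ffun 'M[F]_n -> R^o} -> Prop) (W' : {ffun 'M[F]_m -> R^o} -> Prop) : Prop :=
  exists t : nat, (1 <= t <= m)%N /\
  exists B : {ffun 'M[F]_n -> R^o} -> {ffun 'M[F]_m -> R^o} -> R,
    [/\ bilinear_on W W' B,
        (forall f f', deriv_ker chi W (@rho n) (n - t) f -> W' f' -> B f f' = 0),
        (forall f f', W f -> deriv_ker chi' W' (@rho m) (m - t) f' -> B f f' = 0),
        (forall (g : 'M[F]_t) f f', g \in unitmx -> W f -> W' f' ->
            B (rho (embmx n g) f) (rho (embmx m g) f') = B f f')
      & exists f f', [/\ W f, W' f' & B f f' != 0]].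

(** H-equivariance: B(hW, hW') = chi(h) B(W, W') for h = g u in H = G_m U_{n,n-m-1},
    with U_{n,n-m-1} acting trivially on W'. *)
Definition H_equivariant (chi : F -> R) (n m : nat)
    (W : {ffun 'M[F]_n -> R^o} -> Prop) (W' : {ffun 'M[F]_m -> R^o} -> Prop)
    (B : {ffun 'M[F]_n -> R^o} -> {ffun 'M[F]_m -> R^o} -> R) : Prop :=
  forall (g : 'M[F]_m) (u : 'M[F]_n) f f', g \in unitmx -> u \in @Uhmx n m ->
    W f -> W' f' ->
    B (rho (embmx n g *m u) f) (rho g f') = psiN chi u * B f f'.

Definition Ncosets (m : nat) : {set {set 'M[F]_m}} :=
  [set [set u *m g | u in @Nmx m] | g in [pred g : 'M[F]_m | g \in unitmx]].

Definition crep (m : nat) (C : {set 'M[F]_m}) : 'M[F]_m := odflt 0 [pick x in C].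

Definition Izeta (n m : nat) (f : {ffun 'M[F]_n -> R^o}) (f' : {ffun 'M[F]_m -> R^o}) : R :=
  \sum_(C in Ncosets m) f (embmx n (crep C)) * f' (crep C).

End Defs.

Arguments Nmx {F} k.
Arguments Umx {F} r.
Arguments Uhmx {F} n m.

(** The additive character psi_R = image in R of psi = zeta_p ^ ell, where
    zeta is the image of zeta_p and ell : F_q -> F_p is additive. *)
Definition psiR (F : finFieldType) (R : comNzRingType) (p : nat) (zeta : R)
    (ell : F -> 'F_p) (a : F) : R := zeta ^+ (ell a : nat).

(* Main.v *)
(** Let U_{s+1} be the group of matrices [ublock y] with [y] a column of height
    s. Restricted to U_{t+1}, a form B that is equivariant for the unipotent
    columns beyond t and for G_t splits along the characters of U_{t+1}. The
    trivial character contributes a G_t-invariant form on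
    W^{(n-t)} x W'^{(m-t)}, which vanishes because pi' is not exceptional; the
    nontrivial characters form one G_t-orbit, so B is determined by the
    component of the character y |-> psi(y_t), an equivariant form for t - 1.
    Descending from t = m to t = 0, B is determined by a form that factors
    through the two top derivatives, i.e. a scalar multiple of
    (f, f') |-> f(1) f'(1). For the zeta sum this scalar is a power of q,
    hence a unit. *)
Require Import Defs.
From HB Require Import structures.
From mathcomp Require Import all_boot all_order all_algebra.
From mathcomp Require Import finfield zify.
Import GRing.Theory.
Set Implicit Arguments. Unset Strict Implicit. Unset Printing Implicit Defensive.
Local Open Scope ring_scope.

(** * Unipotent columns and superdiagonals *)

Section Embedding.
Variable F : finFieldType.

Lemma mxget_ord k (g : 'M[F]_k) (i j : 'I_k) : mxget g i j = g i j.
Proof. by rewrite /mxget !valK. Qed.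

Lemma eq_mxget k (g h : 'M[F]_k) :
  (forall i j, (i < k)%N -> (j < k)%N -> mxget g i j = mxget h i j) -> g = h.
Proof. by move=> e; apply/matrixP=> i j; rewrite -!mxget_ord e. Qed.

Lemma mxget_emb n k (g : 'M[F]_k) i j : (i < n)%N -> (j < n)%N ->
  mxget (embmx n g) i j =
    if (i < k)%N && (j < k)%N then mxget g i j else (i == j)%:R.
Proof.
by move=> lin ljn; rewrite -[i]/(val (Ordinal lin)) -[j]/(val (Ordinal ljn))
  mxget_ord mxE.
Qed.

Lemma embmx_id n (g : 'M[F]_n) : embmx n g = g.
Proof. by apply: eq_mxget => i j lin ljn; rewrite mxget_emb // lin ljn. Qed.

Lemma embmx_emb n l k (g : 'M[F]_k) : (k <= l)%N ->
  embmx n (embmx l g) = embmx n g.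
Proof.
move=> lekl; apply: eq_mxget => i j lin ljn.
rewrite [LHS]mxget_emb // [RHS]mxget_emb //.
case: ifP => [/andP[lil ljl] | h]; first by rewrite mxget_emb.
case: ifP => // /andP[lik ljk]; move: h.
by rewrite (leq_trans lik lekl) (leq_trans ljk lekl).
Qed.

Lemma embmxE k d (g : 'M[F]_k) : embmx (k + d) g = block_mx g 0 0 1%:M.
Proof.
apply/matrixP=> i j; rewrite mxE.
case: (split_ordP i) => i' ->; case: (split_ordP j) => j' -> /=;
  rewrite ?ltn_ord ?ltnNge ?leq_addr /= ?andbF.
- by rewrite block_mxEul mxget_ord.
- by rewrite block_mxEur mxE ltn_eqF // (leq_trans (ltn_ord i')) ?leq_addr.
- by rewrite block_mxEdl mxE gtn_eqF // (leq_trans (ltn_ord j')) ?leq_addr.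
- by rewrite block_mxEdr mxE eqn_add2l.
Qed.

Lemma embmxM n k (g h : 'M[F]_k) : (k <= n)%N ->
  embmx n (g *m h) = embmx n g *m embmx n h.
Proof.
move=> /subnKC <-.
by rewrite !embmxE mulmx_block !mulmx0 !mul0mx !addr0 !add0r mulmx1.
Qed.

Lemma embmx1 n k : (k <= n)%N -> embmx n (1%:M : 'M[F]_k) = 1%:M.
Proof. by move=> /subnKC <-; rewrite embmxE -scalar_mx_block. Qed.

Lemma embmx_unit n k (g : 'M[F]_k) : (k <= n)%N -> g \in unitmx ->
  embmx n g \in unitmx.
Proof.
by move=> /subnKC <- gu; rewrite embmxE unitmxE det_ublock det1 mulr1 -unitmxE.
Qed.

Definition ublock s (y : 'cV[F]_s) : 'M[F]_(s + 1) := block_mx 1%:M y 0 1%:M.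

Lemma ublockD s (y z : 'cV[F]_s) : ublock (y + z) = ublock y *m ublock z.
Proof.
rewrite /ublock mulmx_block !mulmx0 !mul0mx !mulmx1 !mul1mx.
by rewrite !addr0 !add0r addrC.
Qed.

Lemma ublock0 s : ublock (0 : 'cV[F]_s) = 1%:M.
Proof. by rewrite /ublock -scalar_mx_block. Qed.

Lemma ublock_unit s (y : 'cV[F]_s) : ublock y \in unitmx.
Proof. by rewrite unitmxE det_ublock !det1 mulr1 unitr1. Qed.

Lemma emb_ublockD n s (y z : 'cV[F]_s) : (s < n)%N ->
  embmx n (ublock (y + z)) = embmx n (ublock y) *m embmx n (ublock z).
Proof. by move=> lsn; rewrite ublockD embmxM ?addn1. Qed.

Lemma emb_ublock0 n s : (s < n)%N -> embmx n (ublock (0 : 'cV[F]_s)) = 1%:M.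
Proof. by move=> lsn; rewrite ublock0 embmx1 ?addn1. Qed.

Lemma emb_ublock_unit n s (y : 'cV[F]_s) : (s < n)%N ->
  embmx n (ublock y) \in unitmx.
Proof. by move=> lsn; rewrite embmx_unit ?ublock_unit ?addn1. Qed.

(** G_s acts linearly on the column group U_{s+1} by conjugation. All later transport of characters
    of columns rests on this relation. *)
Lemma emb_ublockC n s (g : 'M[F]_s) (y : 'cV[F]_s) : (s < n)%N ->
  embmx n g *m embmx n (ublock y) = embmx n (ublock (g *m y)) *m embmx n g.
Proof.
move=> lsn; rewrite -(embmx_emb n g (leq_addr 1 s)) -!embmxM ?addn1 //.
rewrite embmxE /ublock !mulmx_block.
by rewrite !mulmx0 !mul0mx !mulmx1 !mul1mx !addr0 !add0r.
Qed.

Lemma block_ublockM k (v : 'M[F]_k) (y : 'cV[F]_k) :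
  block_mx v y 0 1%:M = ublock y *m embmx (k + 1) v.
Proof.
rewrite embmxE /ublock mulmx_block.
by rewrite !mulmx0 !mul0mx !mulmx1 !mul1mx !addr0 !add0r.
Qed.

(** Characters of a column group are indexed by row vectors, and this row gives y |-> psi(y_s).
    Testing [i.+1 == s] makes it available for every s, with the empty row at s = 0. *)
Definition lastrow s : 'rV[F]_s := \row_(i < s) (i.+1 == s)%:R.

Lemma lastrowE s : lastrow (s + 1) = row_mx 0 1%:M.
Proof.
apply/rowP=> i; rewrite mxE; case: (split_ordP i) => i' -> /=.
  by rewrite row_mxEl mxE addn1 eqSS ltn_eqF.
by rewrite row_mxEr !ord1 mxE addn0 addn1 eqxx.
Qed.

Lemma lastrow_emb s k (g : 'M[F]_k) : (k < s)%N ->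
  lastrow s *m embmx s g = lastrow s.
Proof.
case: s => // s; rewrite ltnS -(addn1 s) => leks.
rewrite -(embmx_emb _ g leks) embmxE lastrowE mul_row_block.
by rewrite !mulmx0 !mul0mx !mulmx1 !addr0 !add0r.
Qed.

Lemma lastrow_ublock s k (y : 'cV[F]_k) : (k < s)%N ->
  lastrow s *m embmx s (ublock y) = lastrow s.
Proof.
rewrite leq_eqVlt => /predU1P[<- | lks]; last first.
  by rewrite lastrow_emb // addn1.
rewrite -(addn1 k) embmx_id lastrowE mul_row_block.
by rewrite !mulmx0 !mul0mx !mulmx1 !addr0 !add0r.
Qed.

Definition rcdot s (c : 'rV[F]_s) (y : 'cV[F]_s) : F := (c *m y) 0 0.

Lemma rcdotDl s (c d : 'rV[F]_s) y : rcdot (c + d) y = rcdot c y + rcdot d y.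
Proof. by rewrite /rcdot mulmxDl mxE. Qed.

Lemma rcdotDr s (c : 'rV[F]_s) y z : rcdot c (y + z) = rcdot c y + rcdot c z.
Proof. by rewrite /rcdot mulmxDr mxE. Qed.

Lemma rcdot0 s (c : 'rV[F]_s) : rcdot c 0 = 0.
Proof. by rewrite /rcdot mulmx0 mxE. Qed.

Lemma rcdot0l s (y : 'cV[F]_s) : rcdot 0 y = 0.
Proof. by rewrite /rcdot mul0mx mxE. Qed.

Lemma rcdotNr s (c : 'rV[F]_s) y : rcdot c (- y) = - rcdot c y.
Proof. by rewrite /rcdot mulmxN mxE. Qed.

Lemma rcdotNl s (c : 'rV[F]_s) y : rcdot (- c) y = - rcdot c y.
Proof. by rewrite /rcdot mulNmx mxE. Qed.

Lemma rcdotA s (c : 'rV[F]_s) (g : 'M_s) y : rcdot c (g *m y) = rcdot (c *m g) y.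
Proof. by rewrite /rcdot mulmxA. Qed.

Lemma rcdot_lastrow s (y : 'cV[F]_s.+1) : rcdot (lastrow s.+1) y = y ord_max 0.
Proof.
rewrite /rcdot mxE (bigD1 ord_max) //= big1 => [|i ne]; rewrite mxE eqSS.
  by rewrite eqxx mul1r addr0.
by rewrite -(inj_eq val_inj) /= in ne; rewrite (negPf ne) mul0r.
Qed.

(** This links the entry read by [gen_step] to the pairing with [lastrow]. At s = 0 both indices
    would be 0 and the entry would be the diagonal 1. *)
Lemma mxget_ublock_last s (y : 'cV[F]_s) : (0 < s)%N ->
  mxget (ublock y) s.-1 s = rcdot (lastrow s) y.
Proof.
case: s y => // s y _; rewrite rcdot_lastrow /=.
have -> : mxget (ublock y) s s.+1
    = mxget (ublock y) (lshift 1 (@ord_max s)) (rshift s.+1 (@ord0 0)).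
  by rewrite /= addn0.
by rewrite mxget_ord block_mxEur.
Qed.

Lemma UmxP s (u : 'M[F]_(s + 1)) : reflect (exists y, u = ublock y) (Umx _ u).
Proof.
have predE : (s + 1).-1 = s by rewrite addn1.
apply: (iffP forallP) => [uU | [y ->] i]; last first.
  apply/forallP=> j; apply/implyP; rewrite predE.
  case: (split_ordP i) => i' ->; case: (split_ordP j) => j' -> /=.
  - by rewrite block_mxEul mxE eq_shift.
  - by rewrite !ord1 addn0 eqxx orFb ltn_eqF.
  - by rewrite block_mxEdl mxE eq_shift.
  - by rewrite block_mxEdr mxE eq_shift.
exists (ursubmx u); rewrite -[u in LHS]submxK /ublock.
have uE (i j : 'I_(s + 1)) : ((j : nat) != s) || ((i : nat) == s) -> u i j = (i == j)%:R.
  move=> h; apply/eqP; move/forallP: (uU i) => /(_ j) /implyP; apply.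
  by rewrite predE.
congr block_mx; apply/matrixP=> i j; rewrite !mxE uE /= ?eq_shift //.
- by rewrite ltn_eqF.
- by rewrite ltn_eqF.
- by rewrite !ord1 addn0 eqxx orbT.
Qed.

End Embedding.

Arguments lastrow {F} s.

Section Superdiagonal.
Variable F : finFieldType.

Definition superdiag k (u : 'M[F]_k) : F := \sum_(i < k.-1) mxget u i i.+1.

Lemma superdiag_emb n k (u : 'M[F]_k) : (k <= n)%N ->
  superdiag (embmx n u) = superdiag u.
Proof.
move=> lekn; rewrite /superdiag.
rewrite (big_ord_widen n.-1 (fun i => mxget u i i.+1)); last by lia.
rewrite [RHS]big_mkcond; apply: eq_bigr => i _; have := ltn_ord i => lin.
rewrite mxget_emb; try lia.
have -> : (i < k)%N && (i.+1 < k)%N = (i < k.-1)%N by lia.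
by case: ifP => //; rewrite ltn_eqF.
Qed.

Lemma mxget_block_ul k (u : 'M[F]_k) y z w i j : (i < k)%N -> (j < k)%N ->
  mxget (block_mx u y z w : 'M_(k + 1)) i j = mxget u i j.
Proof.
move=> lik ljk; rewrite [RHS](mxget_ord u (Ordinal lik) (Ordinal ljk)).
by rewrite -(block_mxEul u y z w) -mxget_ord.
Qed.

Lemma mxget_block_ur k (u : 'M[F]_k) y z w (i : 'I_k) :
  mxget (block_mx u y z w : 'M_(k + 1)) i k = y i 0.
Proof.
rewrite -(block_mxEur u y z w) -mxget_ord /=.
by rewrite addn0.
Qed.

Lemma superdiag_block k (u : 'M[F]_k) y z w :
  superdiag (block_mx u y z w : 'M_(k + 1)) =
    superdiag u + rcdot (lastrow k) y.
Proof.
rewrite /superdiag [(k + 1).-1](_ : _ = k) ?addn1 //.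
case: k u y z w => [|k] u y z w.
  by rewrite !big_ord0 (flatmx0 y) rcdot0 addr0.
rewrite big_ord_recr /= rcdot_lastrow -(mxget_block_ur u y z w); congr (_ + _).
by apply: eq_bigr => i _; rewrite mxget_block_ul // ltnS // ltnW.
Qed.

Lemma superdiag_emb_ublock n s (y : 'cV[F]_s) : (s < n)%N ->
  superdiag (embmx n (ublock y)) = rcdot (lastrow s) y.
Proof.
move=> lsn; rewrite superdiag_emb ?addn1 // superdiag_block.
rewrite [superdiag _](_ : _ = 0) ?add0r // /superdiag big1 // => i _.
have := ltn_ord i => lis.
(* Seen as the embedding of the empty matrix, the identity has its entries given by [mxget_emb]. *)
have -> : 1%:M = embmx s (1%:M : 'M[F]_0) by rewrite embmx1.
by rewrite mxget_emb ?ltn_eqF //; lia.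
Qed.

Lemma NmxP k (u : 'M[F]_k) : reflect
  (forall i j : 'I_k, ((j < i)%N -> u i j = 0) /\ u i i = 1) (Nmx k u).
Proof.
apply: (iffP forallP) => [uN i j | uN i].
  have /forallP/(_ j)/andP[/implyP uij _] := uN i.
  have /forallP/(_ i)/andP[_ /implyP uii] := uN i.
  by split; [move=> /uij/eqP | apply/eqP/uii].
apply/forallP=> j; have [uij uii] := uN i j; apply/andP; split.
  by apply/implyP=> /uij ->.
by apply/implyP=> /eqP <-; rewrite uii.
Qed.

Lemma Nmx_block k (u : 'M[F]_(k + 1)) : Nmx (k + 1) u ->
  exists2 v : 'M[F]_k, Nmx k v & exists y, u = block_mx v y 0 1%:M.
Proof.
move=> /NmxP uN; exists (ulsubmx u).
  apply/NmxP=> i j; rewrite !mxE; have [uij uii] := uN (lshift 1 i) (lshift 1 j).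
  by split.
exists (ursubmx u); rewrite -[LHS]submxK; congr block_mx.
  apply/matrixP=> i j; rewrite !mxE; have [-> //] := uN (rshift k i) (lshift 1 j).
  by rewrite /= ltn_addr.
by apply/matrixP=> i j; rewrite !ord1 !mxE; have [] := uN (rshift k 0) (rshift k 0).
Qed.

Lemma Nmx_unit k (u : 'M[F]_k) : Nmx k u -> u \in unitmx.
Proof.
elim: k u => [|k IHk] u; first by rewrite unitmxE det_mx00 unitr1.
move: u; rewrite -(addn1 k) => u /Nmx_block[v vN [y ->]].
by rewrite unitmxE det_ublock det1 mulr1 -unitmxE IHk.
Qed.

Lemma Nmx1 k : Nmx k (1%:M : 'M[F]_k).
Proof.
by apply/NmxP=> i j; rewrite !mxE eqxx; split=> // lji; rewrite -val_eqE gtn_eqF.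
Qed.

Lemma NmxM k (u v : 'M[F]_k) : Nmx k u -> Nmx k v -> Nmx k (u *m v).
Proof.
move=> /NmxP uN /NmxP vN; apply/NmxP=> i j; split=> [lji|].
  rewrite mxE big1 // => l _; have [lli | lil] := ltnP l i.
    by have [-> //] := uN i l; rewrite mul0r.
  by have [-> //] := vN l j; rewrite ?mulr0 // (leq_trans lji).
rewrite mxE (bigD1 i) //= big1 => [|l].
  by have [_ ->] := uN i i; have [_ ->] := vN i i; rewrite mulr1 addr0.
rewrite neq_ltn => /orP[lli | lil].
  by have [-> //] := uN i l; rewrite mul0r.
by have [-> //] := vN l i; rewrite mulr0.
Qed.

Lemma superdiag1 k : superdiag (1%:M : 'M[F]_k) = 0.
Proof.
rewrite -(embmx1 F (leq0n k)) superdiag_emb // /superdiag big_ord0.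
by [].
Qed.

Lemma UhmxP n m (u : 'M[F]_n) : reflect
  (Nmx n u /\ forall i j : 'I_n, (i < j <= m)%N -> u i j = 0) (Uhmx n m u).
Proof.
apply: (iffP forallP) => [uU | [/NmxP uN uU] i].
  split; [apply/NmxP | ] => i j.
    have /forallP/(_ j)/and3P[/implyP uij _ _] := uU i.
    have /forallP/(_ i)/and3P[_ /implyP uii _] := uU i.
    by split; [move=> /uij/eqP | apply/eqP/uii].
  move=> lij; have /forallP/(_ j)/and3P[_ _ /implyP uij] := uU i.
  exact/eqP/uij.
apply/forallP=> j; have [uij uii] := uN i j; apply/and3P; split.
- by apply/implyP=> /uij ->.
- by apply/implyP=> /eqP <-; rewrite uii.
- by apply/implyP=> /uU ->.
Qed.

Lemma Uhmx1 n m : Uhmx n m (1%:M : 'M[F]_n).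
Proof.
apply/UhmxP; split=> [|i j /andP[lij _]]; first exact: Nmx1.
by rewrite mxE -val_eqE ltn_eqF.
Qed.

(** Columns are counted from 0, so m < s puts the nontrivial column after the first m + 1 columns,
    which must be those of the identity. *)
Lemma emb_ublock_Uhmx n m s (y : 'cV[F]_s) : (m < s)%N -> (s < n)%N ->
  Uhmx n m (embmx n (ublock y)).
Proof.
move=> lms lsn.
have /forallP uU : Umx _ (ublock y) by apply/UmxP; exists y.
have eE (i j : 'I_n) : (j != s :> nat) || (s <= i)%N ->
    embmx n (ublock y) i j = (i == j)%:R.
  move=> h; rewrite mxE; case: ifP => [/andP[li lj]|//].
  rewrite (mxget_ord _ (Ordinal li) (Ordinal lj)).
  have /forallP/(_ (Ordinal lj))/implyP uij := uU (Ordinal li).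
  apply/eqP/uij; rewrite [(s + 1).-1](_ : _ = s) ?addn1 //=.
  by have := li; move: h; rewrite addn1 ltnS; lia.
apply/UhmxP; split; first apply/NmxP.
  move=> i j; split=> [lji|].
    by rewrite eE; [rewrite -val_eqE gtn_eqF | lia].
  by rewrite eE ?eqxx ?orNb //; lia.
move=> i j /andP[lij ljm]; rewrite eE ?(ltn_eqF (leq_ltn_trans ljm lms)) //.
by rewrite -val_eqE ltn_eqF.
Qed.

End Superdiagonal.

Lemma psiN_superdiag (F : finFieldType) (R : comNzRingType) (chi : F -> R) n
  (u : 'M[F]_n) : psiN chi u = chi (superdiag u).
Proof. by []. Qed.

(** * Additive characters *)

Section CharacterSums.
Variables (F : finFieldType) (R : comNzRingType).

(** Translating by [gamma t] multiplies the full sum by [theta (gamma t)]; summing over t gives #|T|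
    times the full sum equal to 0. As R may have zero divisors, a single value of theta other than 1
    could not be cancelled, and the invertibility of #|T| takes its place. *)
Lemma char_sum_eq0 (M : finZmodType) (theta : M -> R) (T : finType)
    (gamma : T -> M) :
  (forall a b, theta (a + b) = theta a * theta b) ->
  \sum_t theta (gamma t) = 0 -> (exists u : R, u * #|T|%:R = 1) ->
  \sum_a theta a = 0.
Proof.
move=> thetaD sum0 [u uT].
have shift t : \sum_a theta a = theta (gamma t) * \sum_a theta a.
  rewrite mulr_sumr (reindex (+%R (gamma t))) /=; last first.
    by exists (+%R (- gamma t)) => a _; rewrite ?addKr ?addNKr.
  by apply: eq_bigr => a _; rewrite thetaD.
have : \sum_(t : T) \sum_a theta a = 0.
  by rewrite (eq_bigr _ (fun t _ => shift t)) -mulr_suml sum0 mul0r.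
rewrite sumr_const -[_ *+ _]mulr_natl => /(congr1 ( *%R u)).
by rewrite mulrA uT mul1r mulr0.
Qed.

Variable chi : F -> R.
Hypotheses (chiD : forall a b, chi (a + b) = chi a * chi b)
  (chi_sum : \sum_a chi a = 0) (cardF_unit : exists u : R, u * #|F|%:R = 1).

(** On a coordinate line where c has a nonzero entry, the pairing runs once through F, so chi
    already sums to zero there. *)
Lemma sum_rcdot_col s (c : 'rV[F]_s) : c != 0 ->
  \sum_(y : 'cV[F]_s) chi (rcdot c y) = 0.
Proof.
move=> /rV0Pn[i ci].
apply: (char_sum_eq0 (gamma := fun a => a *: delta_mx i 0)) cardF_unit.
  by move=> y z; rewrite rcdotDr chiD.
rewrite (reindex (fun a => a * (c 0 i)^-1)) /=; last first.
  by exists (fun a => a * c 0 i) => a _; rewrite ?mulfVK ?mulfK.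
rewrite -[RHS]chi_sum; apply: eq_bigr => a _.
by rewrite /rcdot -scalemxAr -colE !mxE mulfVK.
Qed.

Lemma sum_rcdot_row s (y : 'cV[F]_s) : y != 0 ->
  \sum_(c : 'rV[F]_s) chi (rcdot c y) = 0.
Proof.
move=> y0; rewrite (reindex trmx) /=; last by exists trmx => ? _; rewrite trmxK.
have -> : \sum_(z : 'cV_s) chi (rcdot z^T y) = \sum_(z : 'cV_s) chi (rcdot y^T z).
  apply: eq_bigr => z _; congr chi.
  by rewrite /rcdot -[y^T *m z]trmxK trmx_mul trmxK [RHS]mxE.
by rewrite sum_rcdot_col // -(inj_eq trmx_inj) trmxK trmx0.
Qed.

End CharacterSums.

Section Psi.
Variables (p : nat) (F : finFieldType) (R : comNzRingType).
Hypotheses (p_prime : prime p) (charF : p \in [pchar F]).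
Hypothesis p_unit : exists u : R, u * p%:R = 1.
Variables (zeta : R) (ell : F -> 'F_p).
Hypotheses (zeta_cyclo : \sum_(i < p) zeta ^+ i = 0)
  (ell_add : forall a b, ell (a + b) = ell a + ell b)
  (ell_nontriv : exists a, ell a != 0).

Lemma card_charp_unit : exists u : R, u * #|F|%:R = 1.
Proof.
have [u up] := p_unit; exists (u ^+ logn p #|F|).
by rewrite [in X in _ * X](card_pprimeChar charF) natrX -exprMn up expr1n.
Qed.

Lemma zeta_expp : zeta ^+ p = 1.
Proof. by apply/eqP; rewrite -subr_eq0 subrX1 zeta_cyclo mulr0. Qed.

Lemma psiRD a b : psiR zeta ell (a + b) = psiR zeta ell a * psiR zeta ell b.
Proof.
have eqp : (Zp_trunc (pdiv p)).+2 = p.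
  by rewrite Fp_Zcast // Zp_cast // prime_gt1.
rewrite /psiR ell_add -exprD -(expr_mod (_ + _)%N zeta_expp).
by congr (_ ^+ _); rewrite /= [X in (_ %% X)%N]eqp.
Qed.

Lemma psiR0 : psiR zeta ell 0 = 1.
Proof.
have: ell 0 + ell 0 = ell 0 + 0 by rewrite -ell_add !addr0.
by move=> /addrI e; rewrite /psiR e.
Qed.

Lemma ell_mulrn a k : ell (a *+ k) = ell a *+ k.
Proof.
have ell0 : ell 0 = 0 by apply/(addrI (ell 0)); rewrite -ell_add !addr0.
by elim: k => [|k IHk]; rewrite ?mulr0n // !mulrS ell_add IHk.
Qed.

Lemma psiR_sum : \sum_a psiR zeta ell a = 0.
Proof.
have [a ella] := ell_nontriv.
(* The multiples of a are scaled so that [ell] sends the i-th one to i; psi then takes the values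
   zeta^i, whose sum is the cyclotomic relation. *)
apply: (char_sum_eq0 (gamma := fun i : 'F_p => a *+ (i / ell a)%R)) psiRD _ _.
  transitivity (\sum_(i : 'F_p) zeta ^+ i).
    apply: eq_bigr => i _; rewrite /psiR ell_mulrn -mulr_natr natr_Zp.
    by rewrite mulrC divfK.
  rewrite -[RHS]zeta_cyclo -!(big_mkord xpredT (fun i => zeta ^+ i)).
  by rewrite Fp_Zcast // Zp_cast // prime_gt1.
by rewrite card_Fp.
Qed.

End Psi.

(** * Derivatives and equivariant forms *)

Section LinearOn.
Variables (R : comNzRingType) (M : lmodType R).
Implicit Types (S : M -> Prop) (mu : M -> R).

Definition submod S : Prop :=
  S 0 /\ forall a x y, S x -> S y -> S (a *: x + y).

(** Forms are constrained only on the Whittaker models, which are predicates on a function space, so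
    linearity is relative to S. *)
Definition linear_on S mu : Prop :=
  forall a x y, S x -> S y -> mu (a *: x + y) = a * mu x + mu y.

Lemma linear_on0 S mu : submod S -> linear_on S mu -> mu 0 = 0.
Proof.
move=> [S0 _] lin; have := lin 1 0 0 S0 S0.
by rewrite scaler0 add0r mul1r -[X in X = _]addr0 => /addrI/esym.
Qed.

Lemma linear_onZ S mu a x : submod S -> linear_on S mu -> S x ->
  mu (a *: x) = a * mu x.
Proof.
move=> Sm lin Sx; rewrite -[a *: x]addr0 lin ?(linear_on0 Sm) ?addr0 //.
by have [] := Sm.
Qed.

Lemma submod_sum S (I : Type) (r : seq I) (k : I -> R) (f : I -> M) :
  submod S -> (forall i, S (f i)) -> S (\sum_(i <- r) k i *: f i).
Proof.
move=> [S0 SL] Sf; elim: r => [|i r IHr]; first by rewrite big_nil.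
by rewrite big_cons; apply: SL.
Qed.

Lemma linear_on_sum S mu (I : Type) (r : seq I) (k : I -> R) (f : I -> M) :
  submod S -> linear_on S mu -> (forall i, S (f i)) ->
  mu (\sum_(i <- r) k i *: f i) = \sum_(i <- r) k i * mu (f i).
Proof.
move=> Sm lin Sf; elim: r => [|i r IHr].
  by rewrite !big_nil (linear_on0 Sm lin).
by rewrite !big_cons lin ?IHr //; apply: submod_sum.
Qed.

Lemma linear_on_span S mu (X : M -> Prop) : submod S -> linear_on S mu ->
  (forall x, X x -> S x /\ mu x = 0) -> forall x, Defs.span X x -> mu x = 0.
Proof.
move=> Sm lin Xmu x [s [Xs ->]].
(* The induction carries membership in S along, because mu is linear only there. *)
suff: S (\sum_(c <- s) c.1 *: c.2) /\ mu (\sum_(c <- s) c.1 *: c.2) = 0 by case.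
elim: s Xs => [|c s IHs] Xs.
  by rewrite big_nil (linear_on0 Sm lin); case: Sm.
have [Sc c0] := Xmu _ (Xs c (mem_head c s)).
have [Ss s0] := IHs (fun d ds => Xs d (mem_behead (s := c :: s) ds)).
rewrite big_cons lin // c0 s0 mulr0 addr0; split=> //.
by case: Sm => _; apply.
Qed.

End LinearOn.

Section Derivatives.
Variables (F : finFieldType) (R : comNzRingType).

Lemma Umx_emb r s (u : 'M[F]_r) : r = (s + 1)%N -> Umx r u ->
  exists y : 'cV[F]_s, (forall n, embmx n u = embmx n (ublock y)) /\
    ((0 < s)%N -> mxget u r.-2 r.-1 = rcdot (lastrow s) y).
Proof.
move=> er; move: u; rewrite er => u /UmxP[y ->]; exists y; split=> // s0.
by rewrite -[RHS]mxget_ublock_last // [(s + 1).-1](_ : _ = s) ?addn1.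
Qed.

(** A functional factors through the k-th derivative as soon as it kills each generator. With d = n
    - k, the twisted steps use U_{s+1} for d < s < n and the untwisted step uses U_{d+1}; for k = 0
    there is no step. *)
Lemma deriv_ker_eq0 (chi : F -> R) n k d (M : lmodType R) (S : M -> Prop)
    (act : 'M[F]_n -> M -> M) (mu : M -> R) :
  (k + d)%N = n -> submod S ->
  (forall g x, g \in unitmx -> S x -> S (act g x)) -> linear_on S mu ->
  (forall s (y : 'cV[F]_s) x, (d < s < n)%N -> S x ->
     mu (act (embmx n (ublock y)) x) = chi (rcdot (lastrow s) y) * mu x) ->
  ((0 < k)%N -> forall (y : 'cV[F]_d) x, S x ->
     mu (act (embmx n (ublock y)) x) = mu x) ->
  forall x, deriv_ker chi S act k x -> mu x = 0.
Proof.
move=> nE Sm Sact lin muU muU1 x.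
case: k nE muU1 => [|k] nE muU1; first by move=> /= ->; exact: linear_on0 lin.
have kill s (y : 'cV[F]_s) v b : (s < n)%N -> S v ->
    mu (act (embmx n (ublock y)) v) = b * mu v ->
    let w := act (embmx n (ublock y)) v - b *: v in S w /\ mu w = 0.
  move=> lsn Sv e /=.
  have Sa : S (act (embmx n (ublock y)) v).
    by apply: Sact => //; apply: emb_ublock_unit.
  rewrite addrC -scaleNr; split; first by case: Sm => _; apply.
  by rewrite lin // e mulNr addNr.
move: x; apply: (linear_on_span Sm lin) => w; rewrite succnK.
move=> [[j [ljk]]|] [u [v [uU Sv ->]]].
  have le : (n - j = (n - j.+1) + 1)%N by rewrite addn1 subnSK //; lia.
  have [y [-> ->]] := Umx_emb le uU; last by lia.
  by apply: kill => //; [lia | apply: muU => //; lia].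
have le : (n - k = d + 1)%N by lia.
have [y [-> _]] := Umx_emb le uU.
apply: kill => //; first by lia.
by rewrite mul1r; apply: muU1.
Qed.

(** The vector is itself a generator, from the twisted step j = n - s - 1, for which the group in
    [gen_step] has size n - j = s + 1. *)
Lemma deriv_ker_twisted (chi : F -> R) n k (M : lmodType R) (S : M -> Prop)
    (act : 'M[F]_n -> M -> M) s (y : 'cV[F]_s) x :
  (0 < s)%N -> (n - k < s < n)%N -> S x ->
  deriv_ker chi S act k
    (act (embmx n (ublock y)) x - chi (rcdot (lastrow s) y) *: x).
Proof.
case: k => [|k] s0 /andP[ltks ltsn] Sx; first by lia.
eexists [:: (1, _)]; split; last by rewrite big_seq1 scale1r.
move=> _ /predU1P[-> | //]; left; exists (n - s.+1)%N.
split; first by rewrite /=; lia.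
have [u uU [uE uy]] : exists2 u : 'M[F]_(n - (n - s.+1)), Umx _ u &
    embmx n u = embmx n (ublock y) /\
    mxget u (n - (n - s.+1)).-2 (n - (n - s.+1)).-1 = rcdot (lastrow s) y.
  have -> : (n - (n - s.+1) = s + 1)%N by lia.
  exists (ublock y); first by apply/UmxP; exists y.
  split=> //.
  by rewrite -[RHS]mxget_ublock_last // [(s + 1).-1](_ : _ = s) ?addn1.
by exists u, x; rewrite uE uy.
Qed.

End Derivatives.

Section Translations.
Variables (F : finFieldType) (R : comNzRingType) (n : nat).
Implicit Types (g h : 'M[F]_n) (f : {ffun 'M[F]_n -> R^o}).

Lemma rhoM g h f : rho (g *m h) f = rho g (rho h f).
Proof. by apply/ffunP=> x; rewrite !ffunE mulmxA. Qed.

Lemma rho1 f : rho 1%:M f = f.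
Proof. by apply/ffunP=> x; rewrite !ffunE mulmx1. Qed.

Lemma rho_linear g a f1 f2 : rho g (a *: f1 + f2) = a *: rho g f1 + rho g f2.
Proof. by apply/ffunP=> x; rewrite !ffunE. Qed.

Lemma rho_sum g (I : Type) (r : seq I) (k : I -> R)
    (f : I -> {ffun 'M[F]_n -> R^o}) :
  rho g (\sum_(i <- r) k i *: f i) = \sum_(i <- r) k i *: rho g (f i).
Proof.
elim: r => [|i r IHr]; last by rewrite !big_cons rho_linear IHr.
by rewrite !big_nil; apply/ffunP=> x; rewrite !ffunE.
Qed.

End Translations.

(** * Fourier projectors for the column groups *)

Section Fourier.
Variables (F : finFieldType) (R : comNzRingType) (chi : F -> R) (qi : R).
Hypotheses (chiD : forall a b, chi (a + b) = chi a * chi b) (chi0 : chi 0 = 1)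
  (chi_sum : \sum_a chi a = 0) (qiK : qi * #|F|%:R = 1).

(* The projector onto the vectors on which the column group [ublock y] acts
   through the character [chi (rcdot c y)]. *)
Definition fourier n t (c : 'rV[F]_t) (f : {ffun 'M[F]_n -> R^o}) :
    {ffun 'M[F]_n -> R^o} :=
  \sum_(y : 'cV[F]_t)
     (qi ^+ t * chi (- rcdot c y)) *: rho (embmx n (ublock y)) f.

Lemma fourierE n t (c : 'rV[F]_t) (f : {ffun 'M[F]_n -> R^o}) x :
  fourier c f x = \sum_(y : 'cV[F]_t)
     qi ^+ t * chi (- rcdot c y) * f (x *m embmx n (ublock y)).
Proof. by rewrite sum_ffunE; apply: eq_bigr => y _; rewrite !ffunE. Qed.

Lemma fourier_linear n t (c : 'rV[F]_t) a (f1 f2 : {ffun 'M[F]_n -> R^o}) :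
  fourier c (a *: f1 + f2) = a *: fourier c f1 + fourier c f2.
Proof.
rewrite /fourier scaler_sumr -big_split /=; apply: eq_bigr => y _.
by rewrite rho_linear scalerDr !scalerA mulrC.
Qed.

(** Substituting g y for y moves g from the column to the character: G_t permutes the projectors as
    it permutes the rows c. *)
Lemma rho_fourier n t (c : 'rV[F]_t) (g : 'M[F]_t) (f : {ffun 'M[F]_n -> R^o}) :
  (t < n)%N -> g \in unitmx ->
  fourier c (rho (embmx n g) f) = rho (embmx n g) (fourier (c *m g) f).
Proof.
move=> ltn gu; rewrite /fourier rho_sum (reindex (mulmx g)) /=; last first.
  by exists (mulmx (invmx g)) => y _; rewrite ?mulKmx ?mulKVmx.
by apply: eq_bigr => y _; rewrite rcdotA -!rhoM emb_ublockC.
Qed.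

Lemma fourier_rho_ublock n t (c : 'rV[F]_t) (z : 'cV[F]_t)
    (f : {ffun 'M[F]_n -> R^o}) : (t < n)%N ->
  fourier c (rho (embmx n (ublock z)) f) = chi (rcdot c z) *: fourier c f.
Proof.
move=> ltn; rewrite /fourier scaler_sumr [RHS](reindex (+%R^~ z)) /=; last first.
  by exists (+%R^~ (- z)) => y _; rewrite ?addrK ?subrK.
apply: eq_bigr => y _; rewrite -rhoM -emb_ublockD // scalerA; congr (_ *: _).
by rewrite mulrCA -chiD rcdotDr opprD addrCA subrr addr0.
Qed.

Lemma rho_ublock_fourier n t (c : 'rV[F]_t) (z : 'cV[F]_t)
    (f : {ffun 'M[F]_n -> R^o}) : (t < n)%N ->
  rho (embmx n (ublock z)) (fourier c f) = chi (rcdot c z) *: fourier c f.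
Proof.
move=> ltn; rewrite -fourier_rho_ublock // /fourier rho_sum.
by apply: eq_bigr => y _; rewrite -!rhoM -!emb_ublockD // addrC.
Qed.

(** Fourier inversion: after exchanging the sums, orthogonality kills each y other than 0, and the
    term y = 0 has coefficient q^t / q^t. *)
Lemma sum_fourier n t (f : {ffun 'M[F]_n -> R^o}) : (t < n)%N ->
  \sum_(c : 'rV[F]_t) fourier c f = f.
Proof.
move=> ltn; rewrite exchange_big (bigD1 0) //= [X in _ + X]big1 => [|y y0].
  rewrite addr0 emb_ublock0 // rho1 -scaler_suml.
  under eq_bigr => c _ do rewrite rcdot0 oppr0 chi0 mulr1.
  rewrite sumr_const card_mx mul1n -mulr_natr natrX -exprMn qiK expr1n.
  by rewrite scale1r.
rewrite -scaler_suml -mulr_sumr (eq_bigr _ (fun c _ => congr1 chi (esym (rcdotNr c y)))).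
rewrite (sum_rcdot_row chiD chi_sum) ?mulr0 ?scale0r //; first by exists qi.
by rewrite oppr_eq0.
Qed.

Lemma submod_fourier n t (W : {ffun 'M[F]_n -> R^o} -> Prop) (c : 'rV[F]_t) f :
  (t < n)%N -> submod W -> (forall g f, g \in unitmx -> W f -> W (rho g f)) ->
  W f -> W (fourier c f).
Proof.
move=> ltn sW rW Wf; apply: submod_sum => // y.
by apply: rW; rewrite ?emb_ublock_unit.
Qed.

End Fourier.

(** The rank one matrix [l^T *m c] sends l to c and is injective on the line of l, so it agrees
    there with an invertible matrix. Hence the nontrivial characters of the column group form one
    orbit. *)
Lemma lastrow_transitive (F : finFieldType) t (c : 'rV[F]_(t + 1)) : c != 0 ->
  exists2 g : 'M[F]_(t + 1), g \in unitmx & lastrow (t + 1) *m g = c.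
Proof.
move=> c0; pose l := lastrow (t + 1) : 'rV[F]_(t + 1).
have lT : l *m l^T = 1%:M.
  by rewrite /l lastrowE tr_row_mx mul_row_col trmx0 mul0mx add0r trmx1 mulmx1.
have lE : l *m (l^T *m c) = c by rewrite mulmxA lT mul1mx.
have l0 : l != 0.
  by apply: contraNneq c0 => l0; rewrite -lE l0 mul0mx.
case: (@complete_unitmx _ _ _ l (l^T *m c)) => [|g gu gE].
  by rewrite lE !rank_rV c0 l0.
by exists g => //; rewrite -/l -gE lE.
Qed.

(** * Descent of equivariant forms from level m to level 0 *)

Section Levels.
Variables (F : finFieldType) (R : comNzRingType) (chi : F -> R) (qi : R).
Hypotheses (chiD : forall a b, chi (a + b) = chi a * chi b) (chi0 : chi 0 = 1)
  (chi_sum : \sum_a chi a = 0) (qiK : qi * #|F|%:R = 1).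
Variables (n m : nat) (lt_mn : (m < n)%N).
Variables (W : {ffun 'M[F]_n -> R^o} -> Prop) (W' : {ffun 'M[F]_m -> R^o} -> Prop).
Hypotheses (sW : submod W) (sW' : submod W').
Hypotheses (rW : forall g f, g \in unitmx -> W f -> W (rho g f))
  (rW' : forall g f, g \in unitmx -> W' f -> W' (rho g f)).

Local Notation form :=
  ({ffun 'M[F]_n -> R^o} -> {ffun 'M[F]_m -> R^o} -> R).

(* The equivariance left after n - t - 1 twisted derivatives of [W] and
   m - t - 1 of [W'], for the group P_{t+1} (for G_m when t = m). *)
Record level t (B : form) : Prop := Level {
  level_bilinear : bilinear_on W W' B;
  level_left : forall s (y : 'cV[F]_s) f f', (t < s < n)%N -> W f -> W' f' ->
    B (rho (embmx n (ublock y)) f) f' = chi (rcdot (lastrow s) y) * B f f';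
  level_right : forall s (y : 'cV[F]_s) f f', (t < s < m)%N -> W f -> W' f' ->
    B f (rho (embmx m (ublock y)) f') = chi (- rcdot (lastrow s) y) * B f f';
  level_GL : forall (g : 'M[F]_t) f f', g \in unitmx -> W f -> W' f' ->
    B (rho (embmx n g) f) (rho (embmx m g) f') = B f f';
  level_ublock : (t < m)%N -> forall (y : 'cV[F]_t) f f', W f -> W' f' ->
    B (rho (embmx n (ublock y)) f) (rho (embmx m (ublock y)) f') = B f f' }.

Local Notation fourier := (fourier chi qi).

Lemma W_fourier t (c : 'rV[F]_t) f : (t < n)%N -> W f -> W (fourier c f).
Proof. by move=> ltn; apply: submod_fourier. Qed.

Lemma W_ublock s (y : 'cV[F]_s) f : (s < n)%N -> W f ->
  W (rho (embmx n (ublock y)) f).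
Proof. by move=> lsn; apply: rW; apply: emb_ublock_unit. Qed.

Lemma bilinear_linear1 (B : form) f' : bilinear_on W W' B -> W' f' ->
  linear_on W (B^~ f').
Proof. by move=> [B1 _] Wf' a x y Wx Wy; apply: B1. Qed.

Lemma bilinear_linear2 (B : form) f : bilinear_on W W' B -> W f ->
  linear_on W' (B f).
Proof. by move=> [_ B2] Wf a x y Wx Wy; apply: B2. Qed.

Lemma bilinear_fourier (B : form) t (c : 'rV[F]_t) : (t < n)%N ->
  bilinear_on W W' B -> bilinear_on W W' (fun f f' => B (fourier c f) f').
Proof.
move=> ltn [B1 B2]; split=> [a f1 f2 f' W1 W2 Wf' | a f f1 f2 Wf W1 W2].
  by rewrite fourier_linear B1 //; apply: W_fourier.
by rewrite B2 //; apply: W_fourier.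
Qed.

(** Projecting along U_{t+1} keeps the equivariance under later columns: U_{t+1} lies in G_s and
    normalizes U_{s+1}, and its elements have last row (0,...,0,1) in G_s, so the last coordinate of
    z is unchanged. *)
Lemma level_leftF t (B : form) (c : 'rV[F]_t) s (z : 'cV[F]_s) f f' :
  level t B -> (t < s < n)%N -> W f -> W' f' ->
  B (fourier c (rho (embmx n (ublock z)) f)) f' =
    chi (rcdot (lastrow s) z) * B (fourier c f) f'.
Proof.
move=> LB /andP[lts lsn] Wf Wf'; have ltn := ltn_trans lts lsn.
have linB := bilinear_linear1 (level_bilinear LB) Wf'.
rewrite !(linear_on_sum _ _ sW linB); try by move=> y; do ?apply: W_ublock.
rewrite mulr_sumr; apply: eq_bigr => y _; rewrite mulrCA; congr (_ * _).
rewrite -rhoM -(embmx_emb n (ublock y) (l := s)) ?addn1 //.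
rewrite emb_ublockC // rhoM (level_left LB) ?lts //; last first.
  by rewrite embmx_emb ?addn1 //; apply: W_ublock.
by rewrite rcdotA lastrow_ublock // embmx_emb ?addn1.
Qed.

Lemma level_down t (B : form) : (t < m)%N -> level (t + 1) B ->
  level t (fun f f' => B (fourier (lastrow (t + 1)) f) f').
Proof.
rewrite -addn1 => ltm LB.
have ltn : (t + 1 < n)%N := leq_ltn_trans ltm lt_mn.
(* The mirabolic P_{t+1} stabilizes the chosen character, hence preserves the projected form. It
   contains G_t and U_{t+1}, which give the last two fields. *)
have PB (g : 'M[F]_(t + 1)) f f' : g \in unitmx ->
    lastrow (t + 1) *m g = lastrow (t + 1) -> W f -> W' f' ->
    B (fourier (lastrow (t + 1)) (rho (embmx n g) f)) (rho (embmx m g) f')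
      = B (fourier (lastrow (t + 1)) f) f'.
  move=> gu lg Wf Wf'; rewrite rho_fourier // lg (level_GL LB) //.
  exact: W_fourier.
split.
- exact: bilinear_fourier (level_bilinear LB).
- move=> s y f f' /andP[lts lsn] Wf Wf'.
  case: (ltngtP (t + 1) s) => [lt1s||es]; last 2 first.
  + by rewrite addn1 ltnS leqNgt lts.
  + case: s / es y lts lsn => y _ _; rewrite fourier_rho_ublock //.
    by rewrite (linear_onZ _ sW (bilinear_linear1 (level_bilinear LB) Wf')) //;
      apply: W_fourier.
  by apply: level_leftF => //; rewrite lt1s.
- move=> s y f f' /andP[lts lsm] Wf Wf'.
  have WFf : W (fourier (lastrow (t + 1)) f) by apply: W_fourier.
  case: (ltngtP (t + 1) s) => [lt1s||es]; last 2 first.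
  + by rewrite addn1 ltnS leqNgt lts.
  + case: s / es y lts lsm => y _ lsm.
    (* Simultaneous invariance under U_{t+2} moves the translation of f' to the left argument with y
       negated, where the projector turns it into a scalar. *)
    rewrite -[F in B F _ = _](rho1) -(@emb_ublock0 F n (t + 1)) // -(addrN y).
    rewrite emb_ublockD // rhoM (level_ublock LB) //; last exact: W_ublock.
    rewrite rho_ublock_fourier // rcdotNr.
    exact: linear_onZ sW (bilinear_linear1 (level_bilinear LB) Wf') WFf.
  by rewrite (level_right LB) // lt1s.
- move=> g f f' gu Wf Wf'.
  rewrite -(embmx_emb n g (leq_addr 1 t)) -(embmx_emb m g (leq_addr 1 t)).
  apply: PB => //; first by rewrite embmx_unit ?leq_addr.
  by rewrite lastrow_emb // addn1.
- move=> _ y f f' Wf Wf'.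
  apply: PB; rewrite ?ublock_unit // -(embmx_id (ublock y)).
  by rewrite lastrow_ublock // addn1.
Qed.

(** A nonzero value would make the component at the trivial character a nonzero G_{t+1}-invariant
    form on W^{(n-t-1)} x W'^{(m-t-1)}, so pi' would be exceptional. *)
Lemma level_fourier0 t (B : form) : (t < m)%N -> level (t + 1) B ->
  ~ exceptional chi (fun a => chi (- a)) W W' ->
  forall f f', W f -> W' f' -> B (fourier (0 : 'rV[F]_(t + 1)) f) f' = 0.
Proof.
rewrite -addn1 => ltm LB nexc f0 f0' Wf0 Wf0'; apply/eqP.
apply: contra_notT nexc => B0.
have ltn : (t + 1 < n)%N := leq_ltn_trans ltm lt_mn.
have BL := bilinear_fourier (0 : 'rV[F]_(t + 1)) ltn (level_bilinear LB).
exists (t + 1)%N; split; first by rewrite ltm addn1.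
exists (fun f f' => B (fourier (0 : 'rV[F]_(t + 1)) f) f'); split=> //.
- move=> f f' kf Wf'; move: f kf.
  apply: (@deriv_ker_eq0 _ _ _ _ _ (t + 1)) => //.
  + by rewrite subnK // ltnW.
  + exact: bilinear_linear1 BL Wf'.
  + by move=> s y f lt Wf; apply: level_leftF.
  + by move=> _ y f Wf; rewrite fourier_rho_ublock // rcdot0l chi0 scale1r.
- move=> f f' Wf; move: f'.
  apply: (@deriv_ker_eq0 _ _ _ _ _ (t + 1)) => //.
  + by rewrite subnK.
  + exact: bilinear_linear2 BL Wf.
  + move=> s y f' lt Wf'; rewrite (level_right LB) //; exact: W_fourier.
  (* An untwisted step on the right exists only for t + 1 < m, exactly when [level_ublock] applies;
     the matching translation on the left is absorbed by the trivial character. *)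
  + rewrite subn_gt0 => lt y f' Wf'.
    rewrite -[RHS](level_ublock LB lt y) //; last exact: W_fourier.
    by rewrite rho_ublock_fourier // rcdot0l chi0 scale1r.
- move=> g f f' gu Wf Wf'; rewrite rho_fourier // mul0mx (level_GL LB) //.
  exact: W_fourier.
- by exists f0, f0'.
Qed.

(** By Fourier inversion B is the sum of its components. The one at 0 vanishes by
    non-exceptionality, and G_{t+1} carries every other one to the component at [lastrow]. *)
Lemma level_inj t (B : form) : (t < m)%N -> level (t + 1) B ->
  ~ exceptional chi (fun a => chi (- a)) W W' ->
  (forall f f', W f -> W' f' -> B (fourier (lastrow (t + 1)) f) f' = 0) ->
  forall f f', W f -> W' f' -> B f f' = 0.
Proof.
move=> ltm LB nexc Bl f f' Wf Wf'.
have ltn : (t + 1 < n)%N by rewrite addn1; apply: leq_ltn_trans ltm lt_mn.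
have linB := bilinear_linear1 (level_bilinear LB) Wf'.
rewrite -[f](sum_fourier chiD chi0 chi_sum qiK (t := t + 1)) //.
under eq_bigr => c _ do rewrite -[fourier c f]scale1r.
rewrite (linear_on_sum _ _ sW linB) => [|c]; last exact: W_fourier.
rewrite big1 // => c _; rewrite mul1r.
have [-> | c0] := eqVneq c 0; first exact: level_fourier0 LB nexc _ _ Wf Wf'.
have [g gu <-] := lastrow_transitive c0.
have gnu : embmx n g \in unitmx by apply: embmx_unit gu; apply: ltnW.
have gmu : embmx m g \in unitmx by apply: embmx_unit gu; rewrite addn1.
rewrite -(level_GL LB gu) -?rho_fourier //; last exact: W_fourier.
by apply: Bl; [apply: rW | apply: rW'].
Qed.

(** The composite of the projections made in descending from level t to level 0. On a Whittaker
    function, for t < n, it cuts the restriction to G_t down to N_t. *)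
Fixpoint kirillov t (f : {ffun 'M[F]_n -> R^o}) :=
  if t is t'.+1 then fourier (lastrow (t' + 1)) (kirillov t' f) else f.

Lemma W_kirillov t f : (t < n)%N -> W f -> W (kirillov t f).
Proof.
elim: t => //= t IHt ltn Wf; apply: W_fourier; first by rewrite addn1.
by apply: IHt => //; apply: ltnW.
Qed.

(* By [level_inj], a form of level t is determined by its restriction to the
   bottom piece of the Bernstein-Zelevinsky filtration, a form of level 0. *)
Lemma level_kirillov t (B : form) : (t <= m)%N -> level t B ->
  ~ exceptional chi (fun a => chi (- a)) W W' ->
  level 0 (fun f f' => B (kirillov t f) f') /\
  ((forall f f', W f -> W' f' -> B (kirillov t f) f' = 0) ->
   forall f f', W f -> W' f' -> B f f' = 0).
Proof.
elim: t B => [|t IHt] B ltm LB nexc; first by split.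
have LB1 : level (t + 1) B by rewrite addn1.
have [L0 inj] := IHt _ (ltnW ltm) (level_down ltm LB1) nexc.
by split=> // B0; apply: level_inj LB1 nexc _ => //; apply: inj.
Qed.

(** The columns beyond m lie in U_{n,n-m-1}, and u = 1 gives the invariance under G_m. At t = m the
    conditions on right columns and on U_{t+1} are vacuous. *)
Lemma H_equivariant_level (B : form) : bilinear_on W W' B ->
  H_equivariant chi W W' B -> level m B.
Proof.
move=> BL HB; split=> //.
- move=> s y f f' /andP[lms lsn] Wf Wf'.
  have := HB 1%:M _ f f' (unitmx1 _ _) (emb_ublock_Uhmx y lms lsn) Wf Wf'.
  by rewrite embmx1 ?(ltnW lt_mn) // mul1mx rho1 psiN_superdiag superdiag_emb_ublock.
- by move=> s y f f' /andP[lms lsm]; have := ltn_trans lms lsm; rewrite ltnn.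
- move=> g f f' gu Wf Wf'.
  have := HB g 1%:M f f' gu (Uhmx1 _ _ _) Wf Wf'.
  by rewrite mulmx1 psiN_superdiag superdiag1 chi0 mul1r embmx_id.
- by move=> lmm; have := ltnn m; rewrite lmm.
Qed.

End Levels.

(** * Whittaker functions and the zeta sum *)

Section WhittakerFunctions.
Variables (F : finFieldType) (R : comNzRingType).

(** Left (N_n, psi)-equivariance, imposed one column at a time since the columns generate N_n. *)
Definition whittaker (chi : F -> R) n (f : 'M[F]_n -> R) : Prop :=
  forall s (y : 'cV[F]_s) w, (s < n)%N ->
    f (embmx n (ublock y) *m w) = chi (rcdot (lastrow s) y) * f w.

Variable chi : F -> R.
Hypotheses (chiD : forall a b, chi (a + b) = chi a * chi b) (chi0 : chi 0 = 1).

(** Induction peels off the last column of u, whose last entry is the new superdiagonal term. Only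
    the columns of u itself are tested, so that the result also serves subgroups of N_n such as
    U_{n,n-m-1}. *)
Lemma Nmx_equivariant n k (L : 'M[F]_n -> R) (u : 'M[F]_k) w :
  (k <= n)%N -> Nmx k u ->
  (forall s w, (s < k)%N -> let y := \col_(i < s) mxget u i s in
     L (embmx n (ublock y) *m w) = chi (rcdot (lastrow s) y) * L w) ->
  L (embmx n u *m w) = chi (superdiag u) * L w.
Proof.
elim: k u w => [|k IHk] u w lekn uN uL.
  have -> : u = 1%:M by apply/matrixP; case.
  by rewrite embmx1 // superdiag1 chi0 mul1r mul1mx.
move: u lekn uN uL; rewrite -(addn1 k) => u lekn /Nmx_block[v vN [y ->]] uL.
have lkn : (k < n)%N by rewrite -addn1.
have yE : \col_(i < k) mxget (block_mx v y 0 1%:M : 'M_(k + 1)) i k = y.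
  by apply/colP=> i; rewrite mxE mxget_block_ur.
have lkk : (k < k + 1)%N by rewrite addn1.
have := uL k (embmx n v *m w) lkk; rewrite yE superdiag_block.
rewrite {1}block_ublockM embmxM // embmx_emb ?leq_addr // -mulmxA => ->.
rewrite IHk ?(ltnW lkn) //; first by rewrite chiD mulrA [_ * chi _]mulrC.
move=> s w' lsk; have -> : \col_(i < s) mxget v i s =
    \col_(i < s) mxget (block_mx v y 0 1%:M : 'M_(k + 1)) i s.
  apply/colP=> i; rewrite !mxE mxget_block_ul //.
  exact: ltn_trans (ltn_ord i) lsk.
by apply: uL; rewrite addn1 ltnW.
Qed.

Lemma whittaker_Nmx n k (f : 'M[F]_n -> R) (u : 'M[F]_k) w : (k <= n)%N ->
  whittaker chi f -> Nmx k u -> f (embmx n u *m w) = chi (superdiag u) * f w.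
Proof.
move=> lekn fW uN; apply: Nmx_equivariant => // s w' lsk /=.
by rewrite fW // (leq_trans lsk).
Qed.

(** Columns of u with index at most m are trivial. A later column passes to the left of x, which
    leaves its last coordinate unchanged. *)
Lemma whittaker_Uhmx n m (f : 'M[F]_n -> R) (x : 'M[F]_m) (u : 'M[F]_n) :
  (m < n)%N -> whittaker chi f -> Uhmx n m u ->
  f (embmx n x *m u) = psiN chi u * f (embmx n x).
Proof.
move=> lmn fW /UhmxP[uN uU].
have := @Nmx_equivariant n n (fun w => f (embmx n x *m w)) u 1%:M (leqnn n) uN.
rewrite embmx_id !mulmx1; apply=> s w lsn /=.
have [lsm | lms] := leqP s m; last first.
  rewrite -(embmx_emb n x (ltnW lms)) mulmxA emb_ublockC // -mulmxA fW //.
  by rewrite rcdotA lastrow_emb.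
have -> : \col_(i < s) mxget u i s = 0.
  apply/colP=> i; rewrite !mxE.
  rewrite (mxget_ord u (Ordinal (ltn_trans (ltn_ord i) lsn)) (Ordinal lsn)) uU //=.
  by rewrite ltn_ord.
by rewrite emb_ublock0 // mul1mx rcdot0 chi0 mul1r.
Qed.

End WhittakerFunctions.

Section Zeta.
Variables (F : finFieldType) (R : comNzRingType) (n m : nat).
Implicit Types f : {ffun 'M[F]_n -> R^o}.
Local Notation dual := {ffun 'M[F]_m -> R^o}.

(** Summing over the whole group avoids coset representatives; for t = m and Whittaker functions
    this is [Izeta] times the order of N_m. Smaller t occur in the descent. *)
Definition zeta_sum t f (f' : dual) : R :=
  \sum_(g : 'M[F]_t | g \in unitmx) f (embmx n g) * f' (embmx m g).

Lemma zeta_sum_linear1 t a f1 f2 (f' : dual) :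
  zeta_sum t (a *: f1 + f2) f' = a * zeta_sum t f1 f' + zeta_sum t f2 f'.
Proof.
rewrite /zeta_sum mulr_sumr -big_split; apply: eq_bigr => g _.
by rewrite !ffunE mulrDl mulrA.
Qed.

Lemma zeta_sum_linear2 t a f (f1' f2' : dual) :
  zeta_sum t f (a *: f1' + f2') = a * zeta_sum t f f1' + zeta_sum t f f2'.
Proof.
rewrite /zeta_sum mulr_sumr -big_split; apply: eq_bigr => g _.
by rewrite !ffunE mulrDr mulrCA.
Qed.

Variables (chi : F -> R) (qi : R).
Hypotheses (chiD : forall a b, chi (a + b) = chi a * chi b) (chi0 : chi 0 = 1)
  (chi_sum : \sum_a chi a = 0) (qiK : qi * #|F|%:R = 1).

Let chiNK a : chi a * chi (- a) = 1.
Proof. by rewrite -chiD subrr chi0. Qed.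

Lemma zeta_sum0 f (f' : dual) : zeta_sum 0 f f' = f 1%:M * f' 1%:M.
Proof.
rewrite /zeta_sum (big_pred1 1%:M) => [|g]; first by rewrite !embmx1.
have -> : g = 1%:M by apply/matrixP; case.
by rewrite unitmx1 /= eqxx.
Qed.

(** Moved to the left of g, the column contributes the character of [lastrow *m g]; orthogonality
    against [lastrow] leaves the indicator of the stabilizer of that row. *)
Lemma fourier_lastrow t f (g : 'M[F]_(t + 1)) : (t + 1 < n)%N ->
  whittaker chi f -> fourier chi qi (lastrow (t + 1)) f (embmx n g) =
    if lastrow (t + 1) *m g == lastrow (t + 1) then f (embmx n g) else 0.
Proof.
move=> ltn fW; rewrite fourierE.
under eq_bigr => y _ do
  rewrite emb_ublockC // fW // mulrA -[_ * chi _]mulrA -chiD rcdotA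
          -rcdotNl -rcdotDl addrC.
rewrite -mulr_suml -mulr_sumr; case: ifPn => [/eqP-> | neq].
  rewrite subrr; under eq_bigr => y _ do rewrite rcdot0l chi0.
  by rewrite sumr_const card_mx muln1 -mulr_natr mul1r natrX -exprMn qiK expr1n mul1r.
rewrite (sum_rcdot_col chiD chi_sum) ?mulr0 ?mul0r ?subr_eq0 //; by exists qi.
Qed.

(** The projector restricts the sum to P_{t+1} = U_{t+1} G_t. There the inverse characters of f and
    f' cancel, so each of the q^t columns contributes equally. *)
Lemma zeta_sum_fourier t f (f' : dual) : (m < n)%N -> (t < m)%N ->
  whittaker chi f -> whittaker (fun a => chi (- a)) f' ->
  zeta_sum (t + 1) (fourier chi qi (lastrow (t + 1)) f) f' =
    #|F|%:R ^+ t * zeta_sum t f f'.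
Proof.
move=> lmn ltm fW fW'; have ltn := ltn_trans ltm lmn.
have lt1n : (t + 1 < n)%N by rewrite addn1 (leq_ltn_trans ltm).
rewrite /zeta_sum; under eq_bigr => g _ do rewrite fourier_lastrow //.
pose P (g : 'M[F]_(t + 1)) :=
  (g \in unitmx) && (lastrow (t + 1) *m g == lastrow (t + 1)).
transitivity (\sum_(g | P g) f (embmx n g) * f' (embmx m g)).
  rewrite big_mkcondr; apply: eq_bigr => g _; case: ifP => //.
  by rewrite mul0r.
(* Coordinates on the matrices with last row (0,...,0,1). *)
pose h (p : 'M[F]_t * 'cV[F]_t) : 'M[F]_(t + 1) := block_mx p.1 p.2 0 1%:M.
rewrite (reindex h) /=; last first.
  exists (fun g => (ulsubmx g, ursubmx g)) => [[g y] _ | g].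
    by rewrite /h block_mxKul block_mxKur.
  rewrite inE => /andP[_ /eqP].
  rewrite lastrowE -[X in _ *m X = _]submxK mul_row_block.
  rewrite !mul0mx !mul1mx !add0r => /eq_row_mx[dl dr].
  by rewrite /h -[RHS]submxK dl dr.
transitivity (\sum_(g : 'M[F]_t | g \in unitmx) \sum_(y : 'cV[F]_t)
   f (embmx n g) * f' (embmx m g)); last first.
  rewrite mulr_sumr; apply: eq_bigr => g _.
  by rewrite sumr_const card_mx muln1 -natrX mulr_natl.
rewrite pair_big; apply: eq_big => [[g y] | [g y] _].
  rewrite /P /= andbT [in X in _ && X]/h lastrowE mul_row_block.
  rewrite !mul0mx !mulmx0 !mul1mx !add0r eqxx andbT.
  by rewrite unitmxE det_ublock det1 mulr1 -unitmxE.
have ltm1 : (t + 1 <= m)%N by rewrite addn1.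
have ltn1 : (t + 1 <= n)%N by rewrite ltnW.
rewrite /h /= block_ublockM !embmxM // fW // fW' // !embmx_emb ?leq_addr //.
by rewrite mulrACA chiNK mul1r.
Qed.

Lemma zeta_sum_H_equivariant (g : 'M[F]_m) (u : 'M[F]_n) f (f' : dual) :
  (m < n)%N ->
  whittaker chi f -> g \in unitmx -> Uhmx n m u ->
  zeta_sum m (rho (embmx n g *m u) f) (rho g f') = psiN chi u * zeta_sum m f f'.
Proof.
move=> lmn fW gu uU.
rewrite /zeta_sum [in RHS](reindex (mulmx^~ g)) /=; last first.
  by exists (mulmx^~ (invmx g)) => x _; rewrite ?mulmxK ?mulmxKV.
rewrite mulr_sumr; apply: eq_big => [x | x _]; first by rewrite unitmx_mul gu andbT.
rewrite !ffunE !embmx_id mulmxA -embmxM ?(ltnW lmn) //.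
by rewrite (whittaker_Uhmx chiD chi0) // mulrA.
Qed.

(** The summand is left N_m-invariant because the two characters are inverse, and each coset has as
    many elements as N_m. *)
Lemma zeta_sumE f (f' : dual) : (m < n)%N -> whittaker chi f ->
  whittaker (fun a => chi (- a)) f' ->
  zeta_sum m f f' = #|@Nmx F m|%:R * Izeta f f'.
Proof.
move=> lmn fW fW'; pose phi (x : 'M[F]_m) := f (embmx n x) * f' x.
have phiN u x : Nmx m u -> phi (u *m x) = phi x.
  move=> uN; rewrite /phi embmxM ?(ltnW lmn) //.
  rewrite (whittaker_Nmx chiD chi0 _ (ltnW lmn) fW) //.
  rewrite -{2}[u]embmx_id (whittaker_Nmx _ _ _ (leqnn m) fW') //; last first.
  - by rewrite oppr0.
  - by move=> a b; rewrite opprD chiD.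
  by rewrite mulrACA chiNK mul1r.
pose orb (x : 'M[F]_m) := [set u *m x | u in @Nmx F m].
have orb_id x : x \in orb x.
  by apply/imsetP; exists 1%:M; [exact: Nmx1 | rewrite mul1mx].
have orb_card x : x \in unitmx -> #|orb x| = #|@Nmx F m|.
  move=> xu; rewrite card_imset // => u v /(congr1 (mulmx^~ (invmx x))).
  by rewrite !mulmxK.
have orb_sub u x : Nmx m u -> orb (u *m x) \subset orb x.
  move=> uN; apply/subsetP=> _ /imsetP[v vN ->]; rewrite mulmxA.
  by apply: imset_f; apply: NmxM.
(* Inclusion together with equal cardinality gives equality of cosets, without inverses in N_m. *)
have orb_eq x y : x \in unitmx -> y \in orb x -> y \in unitmx /\ orb y = orb x.
  move=> xu /imsetP[u uN ->]; have uxu : u *m x \in unitmx.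
    by rewrite unitmx_mul xu andbT; apply: Nmx_unit.
  by split=> //; apply/eqP; rewrite eqEcard orb_sub //= !orb_card.
have -> : zeta_sum m f f' = \sum_(x | x \in unitmx) phi x.
  by apply: eq_bigr => x _; rewrite embmx_id.
rewrite (partition_big orb (mem (Ncosets F m))) /=; last first.
  by move=> x xu; apply: imset_f.
rewrite /Izeta mulr_sumr; apply: eq_bigr => C /imsetP[x xu ->].
rewrite -/(orb x) -/(phi _).
(* The coset is nonempty, so [crep] returns one of its elements and never the default 0. *)
have cE : crep (orb x) \in orb x.
  rewrite /crep; case: pickP => //= /(_ x); by rewrite orb_id.
rewrite -(orb_card x xu) mulr_natl -sumr_const; apply: eq_big => y.
  apply/andP/idP => [[yu /eqP <-] // | yx].
  by have [-> ->] := orb_eq _ _ xu yx.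
move=> /andP[yu /eqP yE]; move: cE; rewrite -yE => /imsetP[u uN ->].
by rewrite phiN.
Qed.

End Zeta.

(** * Whittaker models and their functionals *)

Section WhittakerModels.
Variables (F : finFieldType) (R : comNzRingType) (chi : F -> R).
Hypothesis chi0 : chi 0 = 1.
Variables (n : nat) (V : lmodType R) (pi : 'M[F]_n -> V -> V) (lam : V -> R).
Hypotheses (pi_rep : is_rep pi) (lam_gen : whittaker_functional chi pi lam).

Let lam_lin : Rlinear lam. Proof. by case: lam_gen. Qed.

Lemma Rlinear0 : lam 0 = 0.
Proof. by apply: (@linear_on0 _ _ (fun=> True)) => // a x y _ _; apply: lam_lin. Qed.

Lemma whit_linear a x y :
  whit pi lam (a *: x + y) = a *: whit pi lam x + whit pi lam y.
Proof.
apply/ffunP=> g; rewrite !ffunE; case: ifP => gu; last first.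
  by rewrite scaler0 addr0.
by case: pi_rep => -> // _ _; rewrite lam_lin.
Qed.

Lemma rho_whit g v : g \in unitmx -> rho g (whit pi lam v) = whit pi lam (pi g v).
Proof.
move=> gu; apply/ffunP=> x; rewrite !ffunE unitmx_mul gu andbT.
by case: ifP => // xu; case: pi_rep => _ _ ->.
Qed.

Lemma whit1 v : whit pi lam v 1%:M = lam v.
Proof. by rewrite ffunE unitmx1; case: pi_rep => _ ->. Qed.

Lemma Wmodel_submod : submod (Wmodel pi lam).
Proof.
split=> [|a _ _ [v ->] [w ->]]; last first.
  by exists (a *: v + w); rewrite whit_linear.
exists 0; apply/ffunP=> g; rewrite !ffunE; case: ifP => // gu.
have := whit_linear (-1) 0 0 => /ffunP/(_ g).
by rewrite scaleN1r oppr0 addr0 !ffunE gu scaleN1r addNr => ->.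
Qed.

Lemma Wmodel_rho g f : g \in unitmx -> Wmodel pi lam f ->
  Wmodel pi lam (rho g f).
Proof. by move=> gu [v ->]; exists (pi g v); rewrite rho_whit. Qed.

Lemma lam_ublock s (y : 'cV[F]_s) v : (s < n)%N ->
  lam (pi (embmx n (ublock y)) v) = chi (rcdot (lastrow s) y) * lam v.
Proof.
(* U_1 is trivial, so height 0 needs no generator; positive heights come from the twisted steps of
   the n-th derivative. *)
case: s y => [|s] y lsn.
  rewrite (flatmx0 y) emb_ublock0 // rcdot0 chi0 mul1r.
  by case: pi_rep => _ ->.
have [_ lamK _] := lam_gen.
have := lamK _ (deriv_ker_twisted chi pi y (x := v) (ltn0Sn s) _ I).
rewrite subnn lsn => /(_ isT).
by rewrite addrC -scaleNr lam_lin mulNr => /eqP; rewrite addrC subr_eq0 => /eqP.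
Qed.

Lemma Wmodel_whittaker f : Wmodel pi lam f -> whittaker chi f.
Proof.
move=> [v ->] s y w lsn; rewrite !ffunE unitmx_mul emb_ublock_unit //=.
case: ifP => wu; last by rewrite mulr0.
by case: pi_rep => _ _ ->; rewrite ?emb_ublock_unit // lam_ublock.
Qed.

(** The equivariance makes mu factor through V^{(n)}, whose dual is generated by lam; the scalar is
    read off at v0. The final untwisted step concerns the trivial group U_1. *)
Lemma functional_scalar (mu : V -> R) v0 : Rlinear mu -> lam v0 = 1 ->
  (forall s (y : 'cV[F]_s) v, (0 < s < n)%N ->
     mu (pi (embmx n (ublock y)) v) = chi (rcdot (lastrow s) y) * mu v) ->
  (0 < n)%N -> forall v, mu v = mu v0 * lam v.
Proof.
move=> lin lam0 muU n0; have [_ _ /(_ mu lin) gen] := lam_gen.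
case: gen => [|r rE v]; last by rewrite !rE lam0 mulr1.
apply: (@deriv_ker_eq0 _ _ _ _ _ 0) => //; first by rewrite addn0.
  by move=> s y v lsn _; apply: muU.
move=> _ y v _; rewrite (flatmx0 y) emb_ublock0 //.
by case: pi_rep => _ ->.
Qed.

(** The surjection witnessing Whittaker type is r times lam for some r; a vector where it equals 1,
    rescaled by r, is the one sought. *)
Lemma functional_eq1 : whittaker_type chi pi -> exists v, lam v = 1.
Proof.
move=> [lam0 [lin0 surj0 ker0]].
have [_ _ /(_ lam0 lin0) gen] := lam_gen.
have [|r rE] := gen; first by move=> v /ker0.
have [v v1] := surj0 1; exists (r *: v + 0).
by rewrite lam_lin Rlinear0 addr0 -rE.
Qed.

End WhittakerModels.

Section LevelZero.
Variables (F : finFieldType) (R : comNzRingType) (chi : F -> R).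
Hypothesis chi0 : chi 0 = 1.
Variables (n m : nat) (V : lmodType R) (pi : 'M[F]_n -> V -> V) (lam : V -> R)
  (V' : lmodType R) (pi' : 'M[F]_m -> V' -> V') (lam' : V' -> R).
Hypotheses (pi_rep : is_rep pi) (lam_gen : whittaker_functional chi pi lam)
  (pi'_rep : is_rep pi')
  (lam'_gen : whittaker_functional (fun a => chi (- a)) pi' lam').
Hypotheses (n0 : (0 < n)%N) (m0 : (0 < m)%N).
Hypotheses (lam1 : exists v, lam v = 1) (lam'1 : exists v', lam' v' = 1).

(** At level 0 the form is equivariant under all columns in each variable separately, so uniqueness
    of the Whittaker functional applies twice. *)
Lemma level0_scalar B : level chi (Wmodel pi lam) (Wmodel pi' lam') 0 B ->
  exists r, forall f f', Wmodel pi lam f -> Wmodel pi' lam' f' ->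
    B f f' = r * (f 1%:M * f' 1%:M).
Proof.
move=> [[B1 B2] BU BU' _ _]; have [v0 lv0] := lam1; have [v0' lv0'] := lam'1.
have WV v : Wmodel pi lam (whit pi lam v) by exists v.
have WV' v : Wmodel pi' lam' (whit pi' lam' v) by exists v.
have E v v' : B (whit pi lam v) (whit pi' lam' v') =
    B (whit pi lam v0) (whit pi' lam' v') * lam v.
  apply: (functional_scalar pi_rep lam_gen
            (mu := fun v => B (whit pi lam v) (whit pi' lam' v'))) => //.
    by move=> a x y; rewrite (whit_linear pi_rep lam_gen) B1.
  move=> s y w lsn; have /andP[_ ltsn] := lsn.
  by rewrite -rho_whit ?emb_ublock_unit // BU.
have E' v' : B (whit pi lam v0) (whit pi' lam' v') =
    B (whit pi lam v0) (whit pi' lam' v0') * lam' v'.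
  apply: (functional_scalar pi'_rep lam'_gen
            (mu := fun v' => B (whit pi lam v0) (whit pi' lam' v'))) => //.
    by move=> a x y; rewrite (whit_linear pi'_rep lam'_gen) B2.
  move=> s y w lsn; have /andP[_ ltsn] := lsn.
  by rewrite -rho_whit ?emb_ublock_unit // BU'.
exists (B (whit pi lam v0) (whit pi' lam' v0')) => _ _ [v ->] [v' ->].
by rewrite E E' (whit1 _ pi_rep) (whit1 _ pi'_rep) mulrAC mulrA.
Qed.

End LevelZero.

(** * Multiplicity one *)

Section MultiplicityOne.
Variables (F : finFieldType) (R : comNzRingType) (chi : F -> R) (qi : R).
Hypotheses (chiD : forall a b, chi (a + b) = chi a * chi b) (chi0 : chi 0 = 1)
  (chi_sum : \sum_a chi a = 0) (qiK : qi * #|F|%:R = 1).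
Variables (n m : nat) (lt_mn : (m < n)%N).
Variables (W : {ffun 'M[F]_n -> R^o} -> Prop) (W' : {ffun 'M[F]_m -> R^o} -> Prop).
Hypotheses (sW : submod W) (sW' : submod W').
Hypotheses (rW : forall g f, g \in unitmx -> W f -> W (rho g f))
  (rW' : forall g f, g \in unitmx -> W' f -> W' (rho g f)).
Hypotheses (wW : forall f, W f -> whittaker chi f)
  (wW' : forall f', W' f' -> whittaker (fun a => chi (- a)) f').
Hypotheses (nexc : ~ exceptional chi (fun a => chi (- a)) W W')
  (W1 : exists2 f, W f & f 1%:M = 1) (W'1 : exists2 f', W' f' & f' 1%:M = 1)
  (level0 : forall B, level chi W W' 0 B -> exists r, forall f f', W f -> W' f' ->
    B f f' = r * (f 1%:M * f' 1%:M)).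

Local Notation kir := (kirillov chi qi).

Lemma zeta_sum_kirillov t f f' : (t <= m)%N -> W f -> W' f' ->
  zeta_sum t (kir t f) f' =
    (\prod_(i < t) #|F|%:R ^+ i) * (f 1%:M * f' 1%:M).
Proof.
move=> letm Wf Wf'; elim: t letm => [|t IHt] ltm.
  by rewrite big_ord0 mul1r zeta_sum0.
rewrite /= -[in zeta_sum _](addn1 t).
rewrite (zeta_sum_fourier chiD chi0 chi_sum qiK) //; last exact: wW'.
  by rewrite IHt ?(ltnW ltm) // big_ord_recr /= mulrCA mulrA.
by apply: wW; apply: W_kirillov => //; apply: ltn_trans lt_mn.
Qed.

Lemma prod_card_unit t : qi ^+ 'C(t, 2) * \prod_(i < t) #|F|%:R ^+ i = 1.
Proof. by rewrite prodrXr -bin2_sum big_mkord -exprMn qiK expr1n. Qed.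

(** No count of N_m is made: its order divides a zeta sum that is a power of q, obtained from
    functions with value 1 at the identity. *)
Lemma Nmx_card_unit : exists k : R, k * #|@Nmx F m|%:R = 1.
Proof.
have [f Wf f1] := W1; have [f' Wf' f'1] := W'1.
have Wk : W (kir m f) by apply: W_kirillov.
exists (qi ^+ 'C(m, 2) * Izeta (kir m f) f').
rewrite -mulrA [Izeta _ _ * _]mulrC -(zeta_sumE chiD chi0) //; try by auto.
by rewrite zeta_sum_kirillov // f1 f'1 !mulr1 prod_card_unit.
Qed.

Lemma form_scalar B : bilinear_on W W' B -> H_equivariant chi W W' B ->
  exists r, forall f f', W f -> W' f' -> B f f' = r * zeta_sum m f f'.
Proof.
move=> BL HB.
have LB := H_equivariant_level chi0 lt_mn BL HB.
have [L0 _] :=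
  level_kirillov chiD chi0 chi_sum qiK lt_mn sW sW' rW rW' (leqnn m) LB nexc.
have [r rE] := level0 L0.
(* At level 0 the zeta sum becomes q^{C(m,2)} f(1) f'(1), while B becomes r f(1) f'(1). With this
   scalar the difference D vanishes at level 0, hence everywhere by injectivity of the descent. *)
exists (r * qi ^+ 'C(m, 2)) => f f' Wf Wf'; apply/eqP; rewrite -subr_eq0; apply/eqP.
pose D f f' := B f f' - r * qi ^+ 'C(m, 2) * zeta_sum m f f'.
have DL : bilinear_on W W' D.
  have [B1 B2] := BL; split=> [a f1 f2 h Wf1 Wf2 Wh | a h f1 f2 Wh Wf1 Wf2];
    rewrite /D ?B1 ?B2 ?zeta_sum_linear1 ?zeta_sum_linear2 //.
    by rewrite mulrDr opprD addrACA mulrBr [a * (_ * _)]mulrCA.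
  by rewrite mulrDr opprD addrACA mulrBr [a * (_ * _)]mulrCA.
have DH : H_equivariant chi W W' D.
  move=> g u h h' gu uU Wh Wh'; rewrite /D HB //.
  rewrite (zeta_sum_H_equivariant chiD chi0) //; last exact: wW.
  by rewrite mulrBr mulrCA.
have LD := H_equivariant_level chi0 lt_mn DL DH.
have [_ inj] :=
  level_kirillov chiD chi0 chi_sum qiK lt_mn sW sW' rW rW' (leqnn m) LD nexc.
apply: inj Wf Wf' => h h' Wh Wh'.
rewrite /D rE // zeta_sum_kirillov // -mulrA [qi ^+ _ * (_ * _)]mulrA.
by rewrite prod_card_unit mul1r subrr.
Qed.

(** Since the order of N_m is a unit, the properties of [zeta_sum] pass to [Izeta]. *)
Lemma zeta_multiplicity_one : [/\ bilinear_on W W' (@Izeta F R n m),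
  H_equivariant chi W W' (@Izeta F R n m)
  & forall B, bilinear_on W W' B -> H_equivariant chi W W' B ->
      exists! r : R, forall f f', W f -> W' f' -> B f f' = r * Izeta f f'].
Proof.
have [k kK] := Nmx_card_unit.
have ZE f f' : W f -> W' f' -> zeta_sum m f f' = #|@Nmx F m|%:R * Izeta f f'.
  by move=> Wf Wf'; apply: (zeta_sumE chiD chi0) => //; auto.
have IE f f' : W f -> W' f' -> Izeta f f' = k * zeta_sum m f f'.
  by move=> Wf Wf'; rewrite ZE // mulrA kK mul1r.
have WL a f1 f2 : W f1 -> W f2 -> W (a *: f1 + f2) by case: sW => _; apply.
have WL' a f1 f2 : W' f1 -> W' f2 -> W' (a *: f1 + f2) by case: sW' => _; apply.
split=> [||B BL HB].
- split=> [a f1 f2 f' Wf1 Wf2 Wf' | a f f1 f2 Wf Wf1 Wf2]; rewrite !IE //; auto.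
    by rewrite zeta_sum_linear1 mulrDr mulrCA.
  by rewrite zeta_sum_linear2 mulrDr mulrCA.
- move=> g u f f' gu uU Wf Wf'; have /UhmxP[/Nmx_unit uu _] := uU.
  rewrite !IE //; last 2 first.
  + by apply: rW => //; rewrite unitmx_mul uu andbT embmx_unit // ltnW.
  + exact: rW'.
  by rewrite (zeta_sum_H_equivariant chiD chi0 f' lt_mn (wW Wf) gu uU) mulrCA.
have [r rE] := form_scalar BL HB.
exists (r * #|@Nmx F m|%:R); split=> [f f' Wf Wf' | r' r'E].
  by rewrite rE // ZE // mulrA.
(* Uniqueness is tested on the pair ([kir m f], [f']), whose zeta sum is a power of q and can
   therefore be cancelled. *)
have [f Wf f1] := W1; have [f' Wf' f'1] := W'1.
have Wk : W (kir m f) by apply: W_kirillov.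
have := r'E _ _ Wk Wf'; rewrite rE // IE // zeta_sum_kirillov // f1 f'1 !mulr1.
rewrite mulrA => /(congr1 (fun x => x * qi ^+ 'C(m, 2))).
rewrite -!mulrA [_ * qi ^+ _]mulrC prod_card_unit !mulr1 => ->.
by rewrite -mulrA kK mulr1.
Qed.

End MultiplicityOne.

Theorem theorem3p1
  (p : nat) (p_prime : prime p)
  (F : finFieldType) (charF : p \in [pchar F])
  (R : comNzRingType) (R_noeth : noetherian R)
  (* R is a Z[1/p, zeta_p]-algebra: p invertible, zeta the image of zeta_p *)
  (p_unit : exists u : R, u * p%:R = 1) (zeta : R)
  (zeta_cyclo : \sum_(i < p) zeta ^+ i = 0)
  (* psi = zeta_p ^ ell, a nontrivial character of (F_q, +) *)
  (ell : F -> 'F_p) (ell_add : forall a b, ell (a + b) = ell a + ell b)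
  (ell_nontriv : exists a, ell a != 0)
  (n m : nat) (m_ge1 : (1 <= m)%N) (m_lt_n : (m < n)%N)
  (V : lmodType R) (pi : 'M[F]_n -> V -> V) (pi_rep : is_rep pi)
  (V' : lmodType R) (pi' : 'M[F]_m -> V' -> V') (pi'_rep : is_rep pi')
  (V_wt : whittaker_type (psiR zeta ell) pi)
  (V'_wt : whittaker_type (fun a => psiR zeta ell (- a)) pi')
  (lam : V -> R) (lam_gen : whittaker_functional (psiR zeta ell) pi lam)
  (lam' : V' -> R) (lam'_gen : whittaker_functional (fun a => psiR zeta ell (- a)) pi' lam')
  (not_exc : ~ exceptional (psiR zeta ell) (fun a => psiR zeta ell (- a))
                 (Wmodel pi lam) (Wmodel pi' lam')) :
  let W := Wmodel pi lam in
  let W' := Wmodel pi' lam' in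
  [/\ bilinear_on W W' (@Izeta F R n m),
      H_equivariant (psiR zeta ell) W W' (@Izeta F R n m)
    & forall B, bilinear_on W W' B -> H_equivariant (psiR zeta ell) W W' B ->
        exists! r : R, forall f f', W f -> W' f' -> B f f' = r * Izeta f f'].
Proof.
have [qi qiK] := card_charp_unit charF p_unit.
have chi0 := psiR0 zeta ell_add.
have chiN0 : psiR zeta ell (- 0) = 1 by rewrite oppr0.
have [v v1] := functional_eq1 lam_gen V_wt.
have [v' v'1] := functional_eq1 lam'_gen V'_wt.
apply: (zeta_multiplicity_one _ chi0 _ qiK) => //.
- exact: psiRD.
- exact: psiR_sum.
- exact: Wmodel_submod lam_gen.
- exact: Wmodel_submod lam'_gen.
- by move=> g f; apply: Wmodel_rho.
- by move=> g f; apply: Wmodel_rho.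
- by move=> f; apply: Wmodel_whittaker lam_gen _.
- by move=> f; apply: Wmodel_whittaker lam'_gen _.
- by exists (whit pi lam v); [exists v | rewrite whit1].
- by exists (whit pi' lam' v'); [exists v' | rewrite whit1].
- move=> B; apply: (level0_scalar _ lam_gen _ lam'_gen) => //.
  + exact: ltn_trans m_lt_n.
  + by exists v.
  + by exists v'.
Qed.
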